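(* Let $\{S_j\}_{j=1}^N$ ($N\ge2$) be a contractive IFS on a complete metric space $(M,\rho)$ that has the p.c.f. property. Then for any weight vector $\mathbf s\in(0,1)^N$, the $AI_\infty$-graph $(X(\mathbf s),E^{(\infty)})$ is an $(m,1)$-departing (for some positive integer $m$) expansive graph of bounded degree. Consequently the $AI_\infty$-graph $(X(\mathbf s),E^{(\infty)})$ is a hyperbolic augmented tree (i.e. a hyperbolic graph whose vertical part $(X(\mathbf s),E_v)$ is a tree).
   Context: IFS: a contractive IFS on a complete metric space $(M,\rho)$ is a family of maps $S_j:M\to M$, $1\le j\le N$, with Lipschitz constants $r_j<1$; $K$ is its attractor, the unique nonempty compact set with $K=\bigcup_jS_j(K)$. Let $\Sigma=\{1,\dots,N\}$, $\Sigma^*=\bigcup_{n\ge0}\Sigma^n$ the finite words ($\Sigma^0=\{\vartheta\}$, the empty word), and $S_x=S_{i_1}\circ\cdots\circ S_{i_n}$ for $x=i_1\cdots i_n$. P.c.f.: let $\Sigma^\infty$ be the set of infinite words over $\Sigma$, let $\varpi:\Sigma^\infty\to K$ be given by $\{\varpi(i_1i_2\cdots)\}=\bigcap_kS_{i_1\cdots i_k}(K)$, and $\sigma$ the left shift on $\Sigma^\infty$. Let $\mathcal C=\varpi^{-1}\big(\bigcup_{i\ne j}(S_i(K)\cap S_j(K))\big)$ and $\mathcal P=\bigcup_{n\ge1}\sigma^n(\mathcal C)$. The IFS is p.c.f. (post critically finite) if $\mathcal P$ is a finite set. Modified coding tree: for $\mathbf s=(s_1,\dots,s_N)\in(0,1)^N$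 let $s_*=\min_js_j$, $s_x=s_{i_1}\cdots s_{i_m}$ for $x=i_1\cdots i_m$ ($s_\vartheta=1$), $X_0=\{\vartheta\}$, $X_n=X_n(\mathbf s)=\{x=i_1\cdots i_m\in\Sigma^*: s_x\le s_*^n<s_{i_1}\cdots s_{i_{m-1}}\}$ for $n\ge1$, and $X(\mathbf s)=\bigcup_{n\ge0}X_n$. The tree edge set $E_v$ joins $x\in X_n$ and $y\in X_{n+1}$ whenever $x$ is a prefix of $y$; the root is $\vartheta$. The $AI_\infty$-graph is $(X(\mathbf s),E^{(\infty)})$ with $E^{(\infty)}=E_v\cup\bigcup_{n\ge1}\{(x,y)\in X_n\times X_n: x\ne y,\ S_x(K)\cap S_y(K)\ne\emptyset\}$. Graphs: for a rooted (locally finite, connected) graph $(X,E)$ with root $\vartheta$ and graph distance $d$, $|x|=d(\vartheta,x)$; $\mathcal J_m(x)$ is the set of $y$ with $|y|=|x|+m$ such that $x$ lies on some geodesic from $\vartheta$ to $y$; $E_h=\{(x,y)\in E:|x|=|y|\}$; $d_h$ is the graph distance on $(X,E_h)$ ($=\infty$ if no path exists). Expansive: for $x,y\in X$ with $|x|=|y|$, $d_h(x,y)>1$ implies $d_h(u,v)>1$ for all $u\in\mathcal J_1(x),v\in\mathcal J_1(y)$. $(m,k)$-departing: for $x,y\in X$ with $|x|=|y|$, $d_h(x,y)>k$ implies $d_h(u,v)>2k$ for all $u\in\mathcal J_m(x),v\in\mathcal J_m(y)$. Bounded degree: $\sup_x\#\{y:(x,y)\in E\}<\infty$. Hyperbolic: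 with $(x|y)=\frac12(|x|+|y|-d(x,y))$ there is $\delta\ge0$ with $(x|y)\ge\min\{(x|z),(z|y)\}-\delta$ for all $x,y,z\in X$.
   Formalization: The formal theorem also assumes that each map S_j is injective on the attractor K; without this the claim fails, e.g. for two distinct constant maps on a two-point space, where the IFS is p.c.f. but the graph has unbounded degree. *)

(* Defs.v *)
From HB Require Import structures.
From mathcomp Require Import all_boot all_order all_algebra.
From mathcomp Require Import all_classical all_reals all_analysis.

Set Implicit Arguments.
Unset Strict Implicit.
Unset Printing Implicit Defensive.

Import Order.TTheory GRing.Theory Num.Theory.

Local Open Scope classical_set_scope.
Local Open Scope ring_scope.

#[short(type="completeMetricType")]
HB.structure Definition CompleteMetric (R : numDomainType) :=
  {M of Complete M & Metric R M}.

Section Graph.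
Context {R : realType} {V : eqType}.
Implicit Types (e : rel V) (o x y z u v : V).

Definition simple_graph e : Prop := symmetric e /\ irreflexive e.

Definition walk e x y : set (seq V) := [set p | path e x p /\ last x p = y].

(* The infimum of the empty set is [+oo], the value for disconnected points. *)
Definition gdist e x y : \bar R :=
  ereal_inf [set (size p)%:R%:E | p in walk e x y].

Definition geodesic e x y : set (seq V) :=
  walk e x y `&` [set p | (size p)%:R%:E = gdist e x y].

Definition gconnected e : Prop := forall x y, walk e x y !=set0.

Definition level e o x : \bar R := gdist e o x.

Definition descendants e o (m : nat) x : set V :=
  [set y | level e o y = (level e o x + m%:R%:E)%E /\
           exists2 p, geodesic e o y p & x \in o :: p].

Definition horizontal e o : rel V :=
  [rel x y | e x y && (level e o x == level e o y)].

Definition vertical e o : rel V :=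
  [rel x y | e x y && (level e o x != level e o y)].

Definition hdist e o x y : \bar R := gdist (horizontal e o) x y.

Definition expansive e o : Prop :=
  forall x y, level e o x = level e o y -> (1 < hdist e o x y)%E ->
  forall u v, descendants e o 1 x u -> descendants e o 1 y v ->
    (1 < hdist e o u v)%E.

Definition departing e o (m k : nat) : Prop :=
  forall x y, level e o x = level e o y -> (k%:R%:E < hdist e o x y)%E ->
  forall u v, descendants e o m x u -> descendants e o m y v ->
    (((2 * k)%N)%:R%:E < hdist e o u v)%E.

Definition bounded_degree e : Prop :=
  exists B : nat, forall x, ([set y | e x y] #<= `I_B)%card.

(* [fine] sends infinities to 0; it is harmless on a connected graph. *)
Definition gromov_product e o x y : R :=
  (fine (level e o x) + fine (level e o y) - fine (gdist e x y)) / 2.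

Definition hyperbolic e o : Prop :=
  gconnected e /\
  exists2 delta : R, 0 <= delta &
    forall x y z, Num.min (gromov_product e o x z) (gromov_product e o z y)
                  - delta <= gromov_product e o x y.

(* In a simple graph a cyclic sequence of distinct vertices of size 2 is just
   an edge traversed back and forth. *)
Definition is_tree e : Prop :=
  [/\ simple_graph e, gconnected e & forall c, ucycle e c -> (size c < 3)%N].

End Graph.

Arguments gdist R {V} e x y.
Arguments level R {V} e o x.
Arguments descendants R {V} e o m x.
Arguments horizontal R {V} e o.
Arguments vertical R {V} e o.
Arguments hdist R {V} e o x y.
Arguments expansive R {V} e o.
Arguments departing R {V} e o m k.
Arguments gromov_product R {V} e o x y.
Arguments hyperbolic R {V} e o.

Section IFS.
Context {R : realType} {M : completeMetricType R} {N : nat}.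
Implicit Types (S : 'I_N -> M -> M) (K : set M) (w : nat -> 'I_N).

Definition contractive S : Prop :=
  forall j, exists2 r : R, 0 <= r < 1 &
    forall x y, mdist (S j x) (S j y) <= r * mdist x y.

(* By Hutchinson's theorem a contractive [S] has exactly one attractor. *)
Definition attractor S K : Prop :=
  [/\ K !=set0, compact K & K = \bigcup_j (S j @` K)].

Definition wmap S (x : seq 'I_N) : M -> M := foldr (fun i f => S i \o f) id x.

Definition cell S K (x : seq 'I_N) : set M := wmap S x @` K.

Definition shift w : nat -> 'I_N := fun k => w k.+1.

Definition coding S K w : M :=
  get [set p | \bigcap_k cell S K (mkseq w k) = [set p]].

Definition critical_set S K : set (nat -> 'I_N) :=
  coding S K @^-1`
    \bigcup_(ij in [set ij : 'I_N * 'I_N | ij.1 != ij.2])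
       (S ij.1 @` K `&` S ij.2 @` K).

Definition post_critical_set S K : set (nat -> 'I_N) :=
  \bigcup_(n in [set n | (0 < n)%N]) (iter n shift @` critical_set S K).

(* Post-critical finiteness is meant for maps that are injective on [K] (as in
   Kigami's self-similar structures), which is a separate hypothesis,
   [set_inj K (S j)].  It is needed to control the graph: for two distinct
   constant maps on a two-point space the critical set is empty, yet the cells
   of all the words starting with the same letter coincide. *)
Definition pcf S K : Prop := finite_set (post_critical_set S K).

End IFS.

Section AIgraph.
Context {R : realType} {N : nat}.
Variable s : 'I_N -> R.

(* The default value 1 is irrelevant as soon as [0 < N] and all [s i <= 1]. *)
Definition smin : R := \big[Num.min/1]_(i < N) s i.

Definition weight (x : seq 'I_N) : R := \prod_(i <- x) s i.

(* For [x] nonempty, [take (size x).-1 x] is [x] without its last letter; the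
   empty word is never in [X n.+1], since its weight is [1 > smin ^+ n.+1]. *)
Definition X (n : nat) : pred (seq 'I_N) := fun x =>
  if n is 0%N then x == [::]
  else weight x <= smin ^+ n < weight (take (size x).-1 x).

Definition in_X (x : seq 'I_N) : bool := `[< exists n, X n x >].

Definition vertex := {x : seq 'I_N | in_X x}.

Lemma in_X_nil : in_X [::].
Proof. by apply/asboolP; exists 0%N; rewrite /X /=. Qed.

Definition vroot : vertex := exist _ [::] in_X_nil.

Definition parent (x y : vertex) : Prop :=
  exists n, [/\ X n (val x), X n.+1 (val y) & prefix (val x) (val y)].

Definition tree_edge : rel vertex := fun x y => `[< parent x y \/ parent y x >].

Definition AI_horizontal {M : completeMetricType R} (S : 'I_N -> M -> M)
    (K : set M) (x y : vertex) : Prop :=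
  exists n, [/\ (0 < n)%N, X n (val x), X n (val y), x != y &
                cell S K (val x) `&` cell S K (val y) !=set0].

Definition AI_edge {M : completeMetricType R} (S : 'I_N -> M -> M)
    (K : set M) : rel vertex :=
  fun x y => tree_edge x y || `[< AI_horizontal S K x y >].

End AIgraph.

Arguments vroot {R N} s.
Arguments tree_edge {R N} s.
Arguments AI_edge {R N} s {M} S K.

(* Main.v *)
(** Every word of level [n + 1] has a unique prefix of level [n]; send it there.
    Cells of prefixes only grow, so this map preserves adjacency-or-equality,
    which is expansiveness. If a point has two codes that first differ before
    position [l], then every code of it that shares their common prefix becomes
    post-critical after [l] shifts. Post-critical words are finitely many, so
    those that agree on [m] letters coincide. Hence two neighbours [u], [v] of
    [z], whose prefixes [m] levels up are distinct from that of [z], meet the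
    cell of [z] in the same point, and so the prefixes of [u] and [v] are
    adjacent: this is the departing property. It also bounds the degree, a
    neighbour being determined by two post-critical words and a letter.

    For hyperbolicity, a walk from [x] to [y] can be straightened into one that
    goes up, then horizontally, then down. Departing halves horizontal walks when
    both ends go up [m] levels, so [(x|y)] is, up to a constant, the largest level
    at which the ancestors of [x] and [y] are adjacent or equal. Applying departing
    to the ancestors of [x], [z], [y] gives the four-point inequality with loss
    [m]. *)

Require Import Defs.
From HB Require Import structures.
From mathcomp Require Import all_boot all_order all_algebra.
From mathcomp Require Import all_classical all_reals all_analysis.
From mathcomp Require Import lra zify.

Set Implicit Arguments.
Unset Strict Implicit.
Unset Printing Implicit Defensive.

Import Order.TTheory GRing.Theory Num.Theory.
Import numFieldNormedType.Exports.

Local Open Scope classical_set_scope.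
Local Open Scope ring_scope.

Local Notation shift := Defs.shift.

(** * Levelled graphs *)

Section Distance.
Context {R : realType} {V : eqType}.
Implicit Types (e : rel V) (x y z : V) (p q : seq V).

Lemma gdist_le_size e x y p : walk e x y p -> (gdist R e x y <= (size p)%:R%:E)%E.
Proof. by move=> xpy; apply: ereal_inf_lbound; exists p. Qed.

Lemma gdist_leP e x y (n : nat) :
  (gdist R e x y <= n%:R%:E)%E <-> exists2 p, walk e x y p & (size p <= n)%N.
Proof.
split=> [dn|[p xpy pn]]; last first.
  by rewrite (le_trans (gdist_le_size xpy))// lee_fin ler_nat.
apply: contrapT => nex.
suff : ((n.+1)%:R%:E <= gdist R e x y)%E.
  by move=> /le_trans/(_ dn); rewrite lee_fin ler_nat ltnn.
apply/ereal_infP => _ [p xpy <-]; rewrite lee_fin ler_nat ltnNge.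
by apply/negP => pn; apply: nex; exists p.
Qed.

(** Lengths are natural numbers, so a nonempty set of them attains its infimum. *)
Lemma gdist_attained e x y : walk e x y !=set0 ->
  exists2 p, walk e x y p & gdist R e x y = (size p)%:R%:E.
Proof.
move=> [p0 xp0y].
have ex : exists n, `[< exists2 p, walk e x y p & size p = n >].
  by exists (size p0); apply/asboolP; exists p0.
case: (ex_minnP ex) => n /asboolP[p xpy pn] minn.
exists p => //; apply/eqP; rewrite eq_le gdist_le_size//=.
apply/ereal_infP => _ [q xqy <-]; rewrite lee_fin ler_nat pn.
by apply: minn; apply/asboolP; exists q.
Qed.

Lemma walk_cat e x y z p q : walk e x y p -> walk e y z q -> walk e x z (p ++ q).
Proof.
by move=> [ep <-] [eq <-]; split; rewrite /= ?cat_path ?ep ?last_cat.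
Qed.

Lemma walk_rev e x y p : symmetric e -> walk e x y p ->
  exists2 q, walk e y x q & size q = size p.
Proof.
move=> esym [ep <-]; exists (rev (belast x p)); last by rewrite size_rev size_belast.
split; last by case: p {ep} => //= z p; rewrite rev_cons last_rcons.
rewrite rev_path; under eq_path do rewrite esym; exact: ep.
Qed.

End Distance.

(** What the coding tree and the augmented graph share: each edge is horizontal or joins a vertex to
    its parent under [up]. The axioms make the root its own parent, so climbs may overshoot it. *)
Record levelled (V : eqType) (e : rel V) (o : V) (lev : V -> nat) (up : V -> V) :
    Prop := Levelled {
  levelled_sym : symmetric e;
  levelled_irr : irreflexive e;
  lev_root : lev o = 0%N;
  lev_eq0 : forall x, lev x = 0%N -> x = o;
  lev_up : forall x, lev (up x) = (lev x).-1;
  edge_up : forall x, (0 < lev x)%N -> e (up x) x;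
  edge_lev : forall x y, e x y ->
    [\/ lev x = lev y, lev y = (lev x).+1 /\ up y = x |
        lev x = (lev y).+1 /\ up x = y] }.

(** * Levels, descendants and horizontal adjacency *)

Section Levelled.
Context {R : realType} {V : eqType} {e : rel V} {o : V} {lev : V -> nat}
  {up : V -> V} (eL : levelled e o lev up).
Implicit Types (x y z u v : V) (p q : seq V).

Lemma lev_iter n x : lev (iter n up x) = (lev x - n)%N.
Proof. by elim: n => [|n IHn] /=; rewrite ?subn0// (lev_up eL) IHn subnS. Qed.

Lemma iter_up_root n x : (lev x <= n)%N -> iter n up x = o.
Proof. by move=> xn; apply: (lev_eq0 eL); rewrite lev_iter; lia. Qed.

Lemma iter_up_min n x : iter (minn n (lev x)) up x = iter n up x.
Proof. by case: (leqP n (lev x)) => // /ltnW xn; rewrite !iter_up_root. Qed.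

Lemma walk_iter_up n x : (n <= lev x)%N ->
  exists2 p, walk e (iter n up x) x p & size p = n.
Proof.
elim: n => [|n IHn] nx; first by exists [::].
have [p xp pn] := IHn (ltnW nx); exists (iter n up x :: p); last by rewrite /= pn.
by case: xp => ep lp; split=> //=; rewrite ep (edge_up eL)// lev_iter subn_gt0.
Qed.

Lemma lev_walk x y p : walk e x y p -> (lev y <= lev x + size p)%N.
Proof.
case; elim: p x => [x _ /= ->|z p IHp x /= /andP[xz ep] lp]; first by rewrite addn0.
by have := IHp _ ep lp; case: (edge_lev eL xz); lia.
Qed.

(** A walk that gains as many levels as it has steps goes from parent to child at each step. *)
Lemma iter_up_walk x y p : walk e x y p -> lev y = (lev x + size p)%N ->
  iter (size p) up y = x.
Proof.
case; elim: p x => [x _ /= ->//|z p IHp x /= /andP[xz ep] lp ylev].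
have := lev_walk (conj ep lp).
by case: (edge_lev eL xz) => [|[zlev <-] _|]; [lia| |lia]; rewrite (IHp z)//; lia.
Qed.

Lemma levelE x : level R e o x = (lev x)%:R%:E.
Proof.
apply/eqP; rewrite eq_le; apply/andP; split.
  have [p xp ps] := walk_iter_up (leqnn (lev x)).
  apply/gdist_leP; exists p; last by rewrite ps.
  by rewrite -(iter_up_root (leqnn (lev x))).
apply/ereal_infP => _ [p xp <-]; rewrite lee_fin ler_nat.
by have := lev_walk xp; rewrite (lev_root eL).
Qed.

Lemma level_eq x y : (level R e o x == level R e o y) = (lev x == lev y).
Proof. by rewrite !levelE eqe eqr_nat. Qed.

Lemma levelled_connected : gconnected e.
Proof.
have root x : walk e o x !=set0.
  have [p xp _] := walk_iter_up (leqnn (lev x)); exists p.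
  by rewrite -(iter_up_root (leqnn (lev x))).
move=> x y; have [p op] := root x; have [q oq] := root y.
by have [p' xp' _] := walk_rev (levelled_sym eL) op; exists (p' ++ q); exact: walk_cat oq.
Qed.

(** On a geodesic from the root through [x] to [u], neither part gains more levels than its length.
    So the part after [x] has [m] steps, all from parent to child. *)
Lemma descendants_iter_up m x u : descendants R e o m x u -> iter m up u = x.
Proof.
rewrite /descendants /= !levelE => -[+ [p [op pmin]]].
move=> /eqP; rewrite -EFinD eqe -natrD eqr_nat => /eqP ulev xp.
have {pmin} psz : size p = lev u.
  by move: pmin => /= /eqP; rewrite -/(level R e o u) levelE eqe eqr_nat => /eqP.
case/splitPl: xp op psz => p1 p2 xE; subst x => -[+ l12] psz.
rewrite cat_path => /andP[ep1 ep2].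
rewrite last_cat in l12; rewrite size_cat in psz.
have w1 : walk e o (last o p1) p1 by [].
have w2 : walk e (last o p1) u p2 by [].
have := lev_walk w1; have := lev_walk w2; rewrite (lev_root eL) => h2 h1.
have <- : size p2 = m by lia.
by apply: iter_up_walk => //; lia.
Qed.

(** Horizontal distance at most 1, in a form free of infima. *)
Definition hclose x y := (lev x == lev y) && ((x == y) || e x y).

Lemma hclose_refl x : hclose x x.
Proof. by rewrite /hclose !eqxx. Qed.

Lemma hclose_walk x y : hclose x y -> exists2 p, walk e x y p & (size p <= 1)%N.
Proof.
case/andP=> _ /orP[/eqP<-|xy]; first by exists [::].
by exists [:: y] => //; split=> //=; rewrite xy.
Qed.

Lemma horizontal_hclose x y : horizontal R e o x y -> hclose x y.
Proof. by rewrite /horizontal /= level_eq /hclose => /andP[-> ->]; rewrite orbT. Qed.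

Lemma hdist_le1P x y : (hdist R e o x y <= 1)%E <-> hclose x y.
Proof.
rewrite /hdist; split=> [/(gdist_leP _ _ _ 1)[[|z [|//]] [/= ez <-] _]|].
- exact: hclose_refl.
- by apply: horizontal_hclose; rewrite andbT in ez.
move=> /andP[xy /predU1P[->|exy]]; apply/(gdist_leP _ _ _ 1).
  by exists [::].
by exists [:: y] => //; split=> //=; rewrite andbT /horizontal /= level_eq exy xy.
Qed.

Lemma hdist_le2_hclose x y : (hdist R e o x y <= 2%:R%:E)%E ->
  exists2 z, hclose x z & hclose z y.
Proof.
move=> /gdist_leP[[|z [|z' [|//]]] [/= ez <-] _].
- by exists x; exact: hclose_refl.
- by exists z; [apply: horizontal_hclose; rewrite andbT in ez|exact: hclose_refl].
- by move: ez => /and3P[xz zz' _]; exists z; exact: horizontal_hclose.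
Qed.

Lemma verticalE x y : vertical R e o x y = e x y && (lev x != lev y).
Proof. by rewrite /vertical /= level_eq. Qed.

(** * Expansiveness, departure and hyperbolicity through the parent map *)

Hypothesis hclose_up : forall x y, hclose x y -> hclose (up x) (up y).

Lemma hclose_iter_up n x y : hclose x y -> hclose (iter n up x) (iter n up y).
Proof. by move=> xy; elim: n => //= n; exact: hclose_up. Qed.

Lemma levelled_expansive : expansive R e o.
Proof.
move=> x y _ xy u v /descendants_iter_up/= ux /descendants_iter_up/= vy.
move: xy; rewrite -ux -vy !ltNge; apply: contra => /hdist_le1P uv.
by apply/hdist_le1P; exact: hclose_up.
Qed.

Context {m : nat}.
(** The contrapositive of departing: two horizontal steps become at most one, [m] levels up. *)
Hypothesis hclose_depart : forall x y z, hclose x z -> hclose z y ->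
  hclose (iter m up x) (iter m up y).

Lemma levelled_departing : departing R e o m 1.
Proof.
move=> x y _ xy u v /descendants_iter_up ux /descendants_iter_up vy.
move: xy; rewrite -ux -vy !ltNge; apply: contra => /hdist_le2_hclose[z uz zv].
by apply/hdist_le1P; exact: hclose_depart zv.
Qed.

(** Idle steps are allowed, so the image of a horizontal path under [up] keeps its length [h]. *)
Fixpoint hreach (h : nat) x y : Prop :=
  if h is h'.+1 then exists2 z, hclose x z & hreach h' z y else x = y.

Lemma hreach_iter_up n h x y : hreach h x y -> hreach h (iter n up x) (iter n up y).
Proof.
elim: h x => [x ->//|h IHh x [z xz zy]].
by exists (iter n up z); [exact: hclose_iter_up|exact: IHh].
Qed.

(** Consecutive steps merge in pairs by [hclose_depart]; an unpaired last step survives, whence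
    [uphalf]. *)
Lemma hreach_half h x y : hreach h x y ->
  hreach (uphalf h) (iter m up x) (iter m up y).
Proof.
have [n] := ubnP h; elim: n h x => // n IHn [|[|h]] x hn.
- by move=> ->.
- exact: hreach_iter_up.
- move=> [z xz [w zw wy]]; exists (iter m up w); first exact: hclose_depart zw.
  by apply: IHn => //; move: hn; rewrite !ltnS; exact: leq_trans.
Qed.

(* Going up [m] levels halves a horizontal path; once it is longer than [4 m],
   this shortens the total path, so the climb is paid for by the path itself. *)
Lemma hreach_hclose h x y : hreach h x y -> exists2 k,
  hclose (iter k up x) (iter k up y) & (2 * k <= h + 2 * m * minn h (4 * m).+1)%N.
Proof.
have [n] := ubnP h; elim: n h x y => // n IHn [|[|h]] x y hn.
- by move=> ->; exists 0%N => //; exact: hclose_refl.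
- by move=> [z xz <-]; exists 0%N.
move=> /hreach_half/IHn[|k nk kle]; first by rewrite /=; lia.
exists (k + m)%N; first by rewrite !iterD.
have hh : (uphalf h.+2 <= h.+1)%N by rewrite /=; lia.
have hh2 : (2 * uphalf h.+2 <= h.+3)%N by rewrite /=; lia.
move: (uphalf h.+2) hh hh2 kle => u hh hh2 kle.
(* Halving a short path may save too little; the climb is then charged to the minimum, which drops
   by at least 1 because [u < h + 2]. *)
have [hm|hm] := leqP (4 * m).+2 h.+2.
  by rewrite (minn_idPr _) //; [nia|lia].
by rewrite (minn_idPl _); [nia|lia].
Qed.

(* Horizontal steps can be pushed up through vertical ones by [hclose_up], which
   removes the down-up turns from a walk. *)
Lemma walk_up_hreach x y p : walk e x y p -> exists i j h,
  hreach h (iter i up x) (iter j up y) /\ (i + j + h <= size p)%N.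
Proof.
case; elim: p x => [x _ <-|z p IHp x /= /andP[xz ep] lp].
  by exists 0%N, 0%N, 0%N.
have [i [j [h [zy ijh]]]] := IHp _ ep lp.
case: (edge_lev eL xz) => [xzlev|[_ zx]|[_ xz']].
- exists i, j, h.+1; split; last by lia.
  exists (iter i up z) => //; apply: hclose_iter_up.
  by rewrite /hclose xzlev eqxx xz orbT.
- case: i zy ijh => [|i] zy ijh.
    by exists 0%N, j.+1, h; split; [rewrite -zx; exact: (hreach_iter_up 1)|lia].
  by exists i, j, h; split; [rewrite -zx -iterSr|lia].
- by exists i.+1, j, h; split; [rewrite iterSr xz'|lia].
Qed.

Let C := (2 * m * (4 * m).+1)%N.

(** Straightening the walk and closing its horizontal part yields [c]. For a geodesic [p] the last
    inequality says that the Gromov product is at most [c + C / 2]. *)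
Lemma walk_hclose x y p : walk e x y p -> exists c,
  [/\ (c <= lev x)%N, (c <= lev y)%N,
      hclose (iter (lev x - c) up x) (iter (lev y - c) up y) &
      (lev x + lev y <= 2 * c + size p + C)%N].
Proof.
move=> /walk_up_hreach[i [j [h [/hreach_hclose[k + kh] ijh]]]].
rewrite -!iterD => nxy.
have /andP[/eqP lxy _] := nxy; rewrite !lev_iter in lxy.
(* The climb may overshoot the root; the truncated difference then gives level 0. *)
exists (lev x - (k + i))%N; split; [lia|lia| |].
  by rewrite {2}lxy -!minnE minnC iter_up_min (minnC (lev y)) iter_up_min.
have hle : (minn h (4 * m).+1 <= (4 * m).+1)%N by exact: geq_minr.
by rewrite /C; nia.
Qed.

Lemma hclose_walk_iter_up i j x y : (i <= lev x)%N -> (j <= lev y)%N ->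
  hclose (iter i up x) (iter j up y) ->
  exists2 p, walk e x y p & (size p <= (i + j).+1)%N.
Proof.
move=> ix jy /hclose_walk[q xqy q1].
have [p xp pi] := walk_iter_up ix; have [p' yp' pj] := walk_iter_up jy.
have [p'' xp'' ps] := walk_rev (levelled_sym eL) xp.
exists (p'' ++ q ++ p'); first by apply: walk_cat xp'' _; exact: walk_cat xqy _.
by rewrite !size_cat; lia.
Qed.

(** Both close pairs of ancestors are pushed to the lower of their levels [c1] and [c2], then [m]
    levels further, where [hclose_depart] links [x] to [y]. The loss is [C] from straightening,
    [2 * m] from the two climbs and 1 for the horizontal edge. *)
Lemma walk_detour x y z p q : walk e x z p -> walk e z y q ->
  exists2 r, walk e x y r &
    (lev z + size r <= lev y + size p + (C + 2 * m).+1)%N \/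
    (lev z + size r <= lev x + size q + (C + 2 * m).+1)%N.
Proof.
move=> /walk_hclose[c1 [c1x c1z xz cp]] /walk_hclose[c2 [c2z c2y zy cq]].
pose c := (minn c1 c2 - m)%N.
have below n u v b : (b <= lev u)%N -> (b <= lev v)%N -> (n <= b)%N ->
    hclose (iter (lev u - b) up u) (iter (lev v - b) up v) ->
    hclose (iter (lev u - n) up u) (iter (lev v - n) up v).
  move=> bu bv nb /(hclose_iter_up (b - n)); rewrite -!iterD.
  have shift w : (b <= lev w)%N -> (b - n + (lev w - b) = lev w - n)%N by lia.
  by rewrite !shift.
have {}xz := below (minn c1 c2) _ _ _ c1x c1z (geq_minl _ _) xz.
have {}zy := below (minn c1 c2) _ _ _ c2z c2y (geq_minr _ _) zy.
have := hclose_depart xz zy; rewrite -!iterD => xy.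
have hclosec : hclose (iter (lev x - c) up x) (iter (lev y - c) up y).
  rewrite -(iter_up_min (m + _)) -(iter_up_min (m + (lev y - _))) in xy.
  have -> : (lev x - c = minn (m + (lev x - minn c1 c2)) (lev x))%N by lia.
  by have -> : (lev y - c = minn (m + (lev y - minn c1 c2)) (lev y))%N by lia.
have [r xry rc] := hclose_walk_iter_up (leq_subr _ _) (leq_subr _ _) hclosec.
exists r => //.
by case: (leqP c1 c2) => c12; [left|right]; lia.
Qed.

Lemma levelled_hyperbolic : hyperbolic R e o.
Proof.
split; first exact: levelled_connected.
(* Gromov products carry a factor 1/2, so the loss of [walk_detour] is halved. *)
exists ((C + 2 * m).+1%:R / 2) => [|x y z]; first by rewrite divr_ge0.
have [p xzp dxz] := gdist_attained (R := R) (levelled_connected x z).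
have [q zyq dzy] := gdist_attained (R := R) (levelled_connected z y).
have [r xyr rle] := walk_detour xzp zyq.
have [d xyd dxy] := gdist_attained (R := R) (levelled_connected x y).
have dr : (size d <= size r)%N.
  by have := gdist_le_size (R := R) xyr; rewrite dxy lee_fin ler_nat.
rewrite /gromov_product !levelE dxz dzy dxy /=.
have {rle} : (lev z + size d <= lev y + size p + (C + 2 * m).+1)%N \/
    (lev z + size d <= lev x + size q + (C + 2 * m).+1)%N by lia.
move: (C + 2 * m).+1 => D.
rewrite lerBlDr ge_min.
by case => h; apply/orP; [left|right]; move: h; rewrite -(ler_nat R) !natrD; lra.
Qed.

End Levelled.

Arguments hclose {V} e lev x y.

(* On a cycle, both neighbours of a vertex of maximal level are its parent. *)
Lemma levelled_tree (V : eqType) (e : rel V) o lev up :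
  levelled e o lev up -> (forall x y, e x y -> lev x != lev y) -> is_tree e.
Proof.
move=> eL elev; split.
- by split; [exact: (levelled_sym eL)|exact: (levelled_irr eL)].
- exact: (levelled_connected eL).
move=> c /andP[ec uc]; rewrite ltnNge; apply/negP => c3.
have [x xc xmax] : exists2 x, x \in c & forall y, y \in c -> (lev y <= lev x)%N.
  have {ec uc c3} := ltnW (ltnW c3).
  elim: c => // a c IHc _.
  case: c IHc => [|b c] IHc.
    by exists a; rewrite ?mem_head// => y; rewrite inE => /eqP->.
  have [x xc xmax] := IHc isT.
  have [ax|xa] := leqP (lev a) (lev x).
    by exists x; [rewrite in_cons xc orbT|move=> y /predU1P[->//|/xmax]].
  exists a; first exact: mem_head.
  by move=> y /predU1P[->//|/xmax/leq_trans]; apply; exact: ltnW.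
case/rot_to: xc => i s cE.
have {ec} ec : cycle e (x :: s) by rewrite -cE rot_cycle.
have {uc} uc : uniq (x :: s) by rewrite -cE rot_uniq.
have s2 : (1 < size s)%N by rewrite -ltnS; move: c3; rewrite -(size_rot i) cE.
have sc y : y \in s -> (lev y <= lev x)%N.
  by move=> ys; apply: xmax; rewrite -(mem_rot i) cE in_cons ys orbT.
case: s s2 uc ec sc {cE} => [//|a s] s0 /= /andP[_ /andP[as_ _]].
rewrite rcons_path => /andP[xa /andP[_ lx]] sc.
have {s0} ls : last a s \in s by case: s s0 {as_ lx xa sc} => //= b s _; exact: mem_last.
have up_x y : e x y -> (lev y <= lev x)%N -> up x = y.
  by move=> xy; have := elev _ _ xy; case: (edge_lev eL xy) => [->|[->]|[_ ->//]]; lia.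
have := up_x _ xa (sc _ (mem_head _ _)).
rewrite (up_x (last a s)); last 2 first.
- by rewrite (levelled_sym eL).
- by apply: sc; rewrite in_cons ls orbT.
by move=> lE; move: as_; rewrite -lE ls.
Qed.

(** * Words and vertices *)

Lemma exprn_lt_eps (R : realType) (q eps : R) : 0 <= q < 1 -> 0 < eps ->
  exists n, q ^+ n < eps.
Proof.
move=> /andP[q0 q1] e0; have : `|q| < 1 by rewrite ger0_norm.
move=> /cvg_expr/cvgrPdist_lt/(_ _ e0)[n _ /(_ n (leqnn n))].
rewrite /= sub0r normrN ger0_norm ?exprn_ge0//; by exists n.
Qed.

Lemma prefix_of_le (T : eqType) (u v w : seq T) :
  prefix u w -> prefix v w -> (size u <= size v)%N -> prefix u v.
Proof.
by rewrite !prefixE => /eqP uE /eqP vE uv; rewrite -vE take_takel// uE.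
Qed.

(** * Weights of words and the levels [X n] *)

Section Coding.
Context {R : realType} {N : nat} {s : 'I_N -> R}.
Hypotheses (N_gt0 : (0 < N)%N) (s01 : forall j, 0 < s j < 1).
Implicit Types (x y z t : seq 'I_N).

Let s_gt0 j : 0 < s j. Proof. by have /andP[] := s01 j. Qed.
Let s_lt1 j : s j < 1. Proof. by have /andP[] := s01 j. Qed.

Lemma smin_gt0 : 0 < smin s. Proof. exact: lt_bigmin. Qed.

Lemma smin_lt1 : smin s < 1.
Proof. exact: le_lt_trans (bigmin_le _ (Ordinal N_gt0) _) (s_lt1 _). Qed.

Lemma weight_gt0 x : 0 < weight s x. Proof. exact: prodr_gt0. Qed.

Lemma weight_nil : weight s [::] = 1. Proof. exact: big_nil. Qed.

Lemma weight_cat x y : weight s (x ++ y) = weight s x * weight s y.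
Proof. exact: big_cat. Qed.

Lemma weight_rcons x i : weight s (rcons x i) = weight s x * s i.
Proof. by rewrite -cats1 weight_cat /weight big_seq1. Qed.

Lemma weight_le1 x : weight s x <= 1.
Proof.
elim: x => [|i x IHx]; first by rewrite weight_nil.
by rewrite -cat1s weight_cat mulr_ile1 ?(ltW (weight_gt0 _))// /weight big_seq1 ltW.
Qed.

Lemma weight_cat_le x y : weight s (x ++ y) <= weight s x.
Proof. by rewrite weight_cat ger_pMr ?weight_gt0 ?weight_le1. Qed.

Lemma take_pred_rcons x i : take (size (rcons x i)).-1 (rcons x i) = x.
Proof. by rewrite size_rcons -cats1 take_size_cat. Qed.

Lemma X_weight_le n x : X s n x -> weight s x <= smin s ^+ n.
Proof. by case: n => [/eqP->|n /andP[]//]; rewrite weight_nil. Qed.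

(** The root has weight 1. Any other word weighs more than [smin ^+ n] without its last letter,
    which costs at most a factor [smin]. Weights at different levels thus lie in disjoint
    intervals. *)
Lemma X_weight_gt n x : X s n x -> smin s ^+ n.+1 < weight s x.
Proof.
case: n => [/eqP->|n]; first by rewrite weight_nil expr1 smin_lt1.
case/lastP: x => [|x i] /andP[].
  by rewrite /= weight_nil => /le_lt_trans h /h; rewrite ltxx.
rewrite take_pred_rcons weight_rcons => _ xs; rewrite exprSr.
apply: (@lt_le_trans _ _ (weight s x * smin s)).
  by rewrite ltr_pM2r ?smin_gt0.
by rewrite ler_pM2l ?weight_gt0// bigmin_le.
Qed.

Lemma X_inj n m x : X s n x -> X s m x -> n = m.
Proof.
have le a b : X s a x -> X s b x -> (a <= b)%N.
  move=> xa xb; rewrite -ltnS -(ltr_iXn2l smin_gt0 smin_lt1).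
  exact: lt_le_trans (X_weight_gt xb) (X_weight_le xa).
by move=> xn xm; apply/eqP; rewrite eqn_leq !le.
Qed.

(** If [y] properly extended [x], then [y] without its last letter would still extend [x] and weigh
    at most [smin ^+ n]. *)
Lemma X_antichain n x y : X s n x -> X s n y -> prefix x y -> x = y.
Proof.
move=> xn yn /prefixP[t yE].
case/lastP: t yE => [|t i] yE; first by rewrite yE cats0.
case: n xn yn => [/eqP-> /eqP->//|n] /andP[xn _] /andP[_].
rewrite yE -rcons_cat take_pred_rcons => /lt_le_trans/(_ (weight_cat_le _ _)).
by rewrite ltNge xn.
Qed.

(** The cut falls at the first position where the weight is at most [smin ^+ n]. *)
Lemma X_take n x : weight s x <= smin s ^+ n -> exists k, X s n (take k x).
Proof.
move=> xn.
have ex : exists k, weight s (take k x) <= smin s ^+ n.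
  by exists (size x); rewrite take_size.
case: (ex_minnP ex) => k kn kmin; exists k.
case: n {ex xn} kn kmin => [|n] kn kmin.
  have := kmin 0%N; rewrite take0 weight_nil lexx => /(_ isT).
  by rewrite leqn0 => /eqP ->; rewrite take0 /=.
rewrite /X kn /= ltNge; apply/negP.
case: k kn kmin => [|k] kn kmin.
  by move: kn; rewrite take0 weight_nil leNgt exprn_ilt1 ?(ltW smin_gt0) ?smin_lt1.
have [kx|kx] := ltnP k (size x).
  by rewrite size_takel// take_takel// => /kmin; rewrite ltnn.
have := kmin k; rewrite take_oversize//; rewrite take_oversize ?(leqW kx)// in kn.
by move=> /(_ kn); rewrite ltnn.
Qed.

Lemma X_prefix_take n m x : (n <= m)%N -> X s m x -> exists2 y, X s n y & prefix y x.
Proof.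
move=> nm xm; have [|k xk] := @X_take n x.
  apply: le_trans (X_weight_le xm) _.
  by rewrite ler_iXn2l ?smin_gt0 ?smin_lt1.
by exists (take k x) => //; exact: prefix_take.
Qed.

(** The added suffix weighs more than [smin ^+ 2], while weights decay at least like powers of the
    largest [s i]. Hence its length is bounded uniformly in [n]. *)
Lemma X_child_finite : exists2 F : set (seq 'I_N), finite_set F &
  forall n x y, X s n x -> X s n.+1 (x ++ y) -> F y.
Proof.
pose q := \big[Num.max/0]_i s i.
have q01 : 0 <= q < 1.
  rewrite bigmax_lt// andbT.
  exact: (le_trans (ltW (s_gt0 (Ordinal N_gt0))) (le_bigmax _ _ _)).
have [L qL] := exprn_lt_eps q01 (exprn_gt0 2 smin_gt0).
exists [set val y | y in [set: L.-bseq 'I_N]]; first exact/finite_image/finite_finset.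
move=> n x y /X_weight_le xn /X_weight_gt.
rewrite weight_cat => yn.
have ys : smin s ^+ 2 < weight s y.
  rewrite -(ltr_pM2l (exprn_gt0 n smin_gt0)) -exprD addn2.
  by apply: lt_le_trans yn _; rewrite ler_pM2r ?weight_gt0.
have yq : weight s y <= q ^+ size y.
  rewrite /weight (big_nth (Ordinal N_gt0)) -{2}(subn0 (size y)) -prodr_const_nat.
  by apply: ler_prod => i _; rewrite ltW//= /q le_bigmax.
have yL : (size y <= L)%N.
  rewrite leqNgt; apply/negP => /ltnW Ly.
  have := lt_trans qL (lt_le_trans ys yq); rewrite ltNge ler_wiXn2l//.
  - by case/andP: q01.
  - by case/andP: q01 => _ /ltW.
by exists (Bseq yL).
Qed.

End Coding.

(** * Parents of vertices; the tree and the graph are levelled *)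

Section Vertices.
Context {R : realType} {N : nat} {s : 'I_N -> R}.
Hypotheses (N_gt0 : (0 < N)%N) (s01 : forall j, 0 < s j < 1).
Implicit Types (u v w : vertex s).

Definition vlev v : nat := get [set n | X s n (val v)].

(** The default [v] makes the root its own parent. *)
Definition vup v : vertex s := xget v [set u | parent u v].

Lemma X_vlev v : X s (vlev v) (val v).
Proof.
have /asboolP[n xn] := valP v.
by apply: (getPex (P := [set n | X s n (val v)])); exists n.
Qed.

Lemma vlev_eq n v : X s n (val v) -> vlev v = n.
Proof. exact: X_inj (X_vlev v). Qed.

Lemma parentP u v :
  parent u v <-> vlev v = (vlev u).+1 /\ prefix (val u) (val v).
Proof.
split=> [[n [un vn uv]]|[vu uv]]; first by rewrite (vlev_eq un) (vlev_eq vn).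
by exists (vlev u); rewrite -vu; split=> //; exact: X_vlev.
Qed.

Lemma same_level_prefix u v : vlev u = vlev v -> prefix (val u) (val v) -> u = v.
Proof.
move=> uv /(X_antichain s01 (n := vlev v)) h; apply: val_inj.
by apply: h; [rewrite -uv|]; exact: X_vlev.
Qed.

Lemma parent_vup v : (0 < vlev v)%N -> parent (vup v) v.
Proof.
move=> v0; apply: (@xgetPex _ v [set u | parent u v]).
have [x xn xv] := X_prefix_take N_gt0 s01 (leq_pred (vlev v)) (X_vlev v).
have xX : in_X s x by apply/asboolP; exists (vlev v).-1.
exists (exist _ x xX); apply/parentP; split=> //.
by rewrite (@vlev_eq (vlev v).-1 (exist _ x xX))// prednK.
Qed.

(** Two parents are prefixes of one word, hence comparable, hence equal since their levels agree. *)
Lemma parent_unique u v : parent u v -> vup v = u.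
Proof.
move=> /parentP[uv pu]; have : (0 < vlev v)%N by rewrite uv.
move=> /parent_vup/parentP[vuv pv].
have : vlev (vup v) = vlev u by move: vuv; rewrite uv => -[].
by move=> lE; have [|/ltnW] := leqP (size (val u)) (size (val (vup v)));
  [move=> /(prefix_of_le pu pv)/same_level_prefix->|
   move=> /(prefix_of_le pv pu)/same_level_prefix->].
Qed.

Lemma vlev_root : vlev (vroot s) = 0%N.
Proof. exact: vlev_eq. Qed.

Lemma vlev_eq0 v : vlev v = 0%N -> v = vroot s.
Proof. by move=> v0; apply: val_inj; have := X_vlev v; rewrite v0 => /eqP. Qed.

Lemma vlev_up v : vlev (vup v) = (vlev v).-1.
Proof.
have [v0|/parent_vup/parentP[-> _]//] := posnP (vlev v).
rewrite /vup v0; case: xgetP => [u _ /parentP[]|_]; [by rewrite v0|exact: v0].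
Qed.

Lemma prefix_vup v : prefix (val (vup v)) (val v).
Proof.
have [v0|/parent_vup/parentP[]//] := posnP (vlev v).
by rewrite (vlev_eq0 (v := vup v)) ?vlev_up ?v0// prefix0s.
Qed.

Lemma prefix_iter_vup n v : prefix (val (iter n vup v)) (val v).
Proof.
elim: n => [|n IHn]; first exact: prefix_refl.
by apply: prefix_trans IHn; exact: prefix_vup.
Qed.

(** Each climb deletes at least one letter, so [m] levels leave room for [m] letters on which
    post-critical words can be compared. *)
Lemma size_iter_vup n v : (n <= vlev v)%N ->
  (size (val (iter n vup v)) + n <= size (val v))%N.
Proof.
elim: n => [|n IHn] nv; first by rewrite addn0.
apply: leq_trans (IHn (ltnW nv)); rewrite addnS -addSn leq_add2r iterS.
set u := iter n vup v.
have /parent_vup/parentP[uv pu] : (0 < vlev u)%N.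
  suff -> : vlev u = (vlev v - n)%N by rewrite subn_gt0.
  by rewrite /u; elim: (n) => [|k IHk] /=; rewrite ?subn0// vlev_up IHk subnS.
rewrite ltn_neqAle size_prefix// andbT; apply/eqP => su.
have uu : vup u = u.
  by apply: val_inj; move: pu; rewrite prefixE su take_size => /eqP.
by move: uv; rewrite uu; lia.
Qed.

Lemma tree_edge_lev u v : tree_edge s u v <->
  (vlev v = (vlev u).+1 /\ vup v = u) \/ (vlev u = (vlev v).+1 /\ vup u = v).
Proof.
have parent_vupP x y : parent x y <-> vlev y = (vlev x).+1 /\ vup y = x.
  split=> [xy|[yx <-]]; first by have /parentP[? _] := xy; rewrite (parent_unique xy).
  by apply: parent_vup; rewrite yx.
by split=> [/asboolP[]/parent_vupP|[]/parent_vupP h];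
  [left|right|apply/asboolP; left|apply/asboolP; right].
Qed.

Lemma tree_edge_levelled : levelled (tree_edge s) (vroot s) vlev vup.
Proof.
split.
- by move=> u v; apply/asboolP/asboolP => -[]; [right|left|right|left].
- by move=> u; apply/negP => /tree_edge_lev[] []; lia.
- exact: vlev_root.
- exact: vlev_eq0.
- exact: vlev_up.
- by move=> u u0; apply/asboolP; left; exact: parent_vup.
- by move=> u v /tree_edge_lev[]; [constructor 2|constructor 3].
Qed.

Lemma tree_edge_lev_neq u v : tree_edge s u v -> vlev u != vlev v.
Proof. by move=> /tree_edge_lev[] [-> _]; lia. Qed.

Context {M : completeMetricType R} (S : 'I_N -> M -> M) (K : set M).

Lemma AI_horizontalP u v : AI_horizontal S K u v <->
  [/\ vlev u = vlev v, u != v & cell S K (val u) `&` cell S K (val v) !=set0].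
Proof.
split=> [[n [n0 un vn uv uvK]]|[lE uv uvK]].
  by split=> //; rewrite (vlev_eq un) (vlev_eq vn).
exists (vlev u); split=> //; [|exact: X_vlev|by rewrite lE; exact: X_vlev].
rewrite lt0n; apply: contra uv => /eqP u0.
by rewrite (vlev_eq0 u0) (@vlev_eq0 v)// -lE.
Qed.

Lemma AI_edge_levelled : levelled (AI_edge s S K) (vroot s) vlev vup.
Proof.
have [tsym tirr t0 teq0 tup edgeup tlev] := tree_edge_levelled.
split=> //.
- move=> u v; rewrite /AI_edge tsym; congr (_ || _).
  by apply/asboolP/asboolP => /AI_horizontalP[lE uv uvK];
    apply/AI_horizontalP; rewrite eq_sym setIC.
- move=> u; rewrite /AI_edge tirr /=; apply/asboolP => /AI_horizontalP[_].
  by rewrite eqxx.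
- by move=> u /edgeup; rewrite /AI_edge => ->.
- move=> u v /orP[/tlev//|/asboolP/AI_horizontalP[lE _ _]]; by constructor 1.
Qed.

Lemma AI_vertical R' : vertical R' (AI_edge s S K) (vroot s) =2 tree_edge s.
Proof.
move=> u v; rewrite (verticalE AI_edge_levelled) /AI_edge.
have [uv|nuv /=] := boolP (tree_edge s u v); first by rewrite (tree_edge_lev_neq uv).
by apply/andP => -[/asboolP/AI_horizontalP[->]]; rewrite eqxx.
Qed.

(** Cells are nonempty, so sharing a point also covers equal vertices. *)
Lemma hclose_AI u v : K !=set0 -> hclose (AI_edge s S K) vlev u v <->
  vlev u = vlev v /\ cell S K (val u) `&` cell S K (val v) !=set0.
Proof.
move=> [a Ka]; split=> [/andP[/eqP uv]|[uv uvK]].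
- case/predU1P => [->|/orP[/tree_edge_lev_neq|/asboolP/AI_horizontalP[]//]].
    by split=> //; exists (wmap S (val v) a); split; exists a.
  by rewrite uv eqxx.
- rewrite /hclose uv eqxx /=; have [//|nuv /=] := eqVneq u v.
  by apply/orP; right; apply/asboolP/AI_horizontalP.
Qed.

End Vertices.

(** * Codes of points *)

(** Distances to a fixed point of [K] form a compact, hence bounded, set. *)
Lemma compact_mdist_bounded (R : realType) (M : metricType R) (K : set M) :
  compact K -> exists D : R, forall a b, K a -> K b -> mdist a b <= D.
Proof.
move=> cK; have [[a0 _]|K0] := pselect (K !=set0); last first.
  by exists 0 => a b Ka; exfalso; apply: K0; exists a.
have cont : continuous (mdist a0 : M -> R^o).
  move=> x; apply/cvgrPdist_lt => e e0; near=> y.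
  have xy : mdist x y < e.
    near: y; apply: (metricType_numDomainType.cvgr_dist_lt (f := id)); last by [].
    exact: cvg_id.
  have h1 := metric_triangle a0 x y; have h2 := metric_triangle a0 y x.
  by rewrite (metric_sym y) in h2; rewrite ltr_norml; lra.
have /compact_bounded[B [_ HB]] := continuous_compact (continuous_subspaceT cont) cK.
(* [compact_bounded] makes every real above [B] a bound, hence [B + 1]. *)
have {}HB a : K a -> mdist a0 a <= B + 1.
  move=> Ka; have /(_ (mdist a0 a)) := HB (B + 1) ltac:(by rewrite ltrDl).
  move=> /(_ (ex_intro2 _ _ a Ka erefl)); exact/le_trans/ler_norm.
exists (B + 1 + (B + 1)) => a b Ka Kb.
apply: le_trans (metric_triangle _ a0 _) _.
by rewrite (metric_sym a) lerD// HB.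
Unshelve. all: by end_near. Qed.

(** * Infinite words and their first difference *)

Section Words.
Context {N : nat}.
Implicit Types (w : nat -> 'I_N) (x : seq 'I_N).

Lemma iter_shiftE k w j : iter k shift w j = w (k + j)%N.
Proof. by elim: k j => // k IHk j; rewrite iterS /shift IHk addSnnS. Qed.

Lemma mkseq_shift w k : mkseq w k.+1 = w 0%N :: mkseq (shift w) k.
Proof. by rewrite /mkseq /= -[1%N]add1n iotaDl -map_comp. Qed.

Lemma mkseq_add w k j : mkseq w (k + j) = mkseq w k ++ mkseq (iter k shift w) j.
Proof.
rewrite /mkseq iotaD map_cat; congr (_ ++ _).
rewrite add0n -{1}[k]addn0 iotaDl -map_comp.
by apply: eq_map => i /=; rewrite iter_shiftE.
Qed.

Lemma eq_mkseqP w w' k : mkseq w k = mkseq w' k <-> forall i, (i < k)%N -> w i = w' i.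
Proof.
split=> [E i ik|E]; last by apply/eq_in_map => i; rewrite mem_iota => /E.
by rewrite -(nth_mkseq (w i) w ik) E nth_mkseq.
Qed.

Lemma mkseq_prefix w x y : prefix y x -> mkseq w (size x) = x -> mkseq w (size y) = y.
Proof.
move=> /prefixP[t ->]; rewrite size_cat mkseq_add => /eqP.
by rewrite eqseq_cat ?size_mkseq// => /andP[/eqP].
Qed.

Definition diverge w w' k := (forall i, (i < k)%N -> w i = w' i) /\ w k != w' k.

Lemma words_diverge w w' : w <> w' -> exists k, diverge w w' k.
Proof.
move=> ww'; have ex : exists k, w k != w' k.
  apply: contrapT => nex; apply: ww'; apply/funext => k; apply/eqP.
  by apply: contrapT => /negP wk; apply: nex; exists k.
case: (ex_minnP ex) => k wk kmin; exists k; split=> // i ik.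
by apply/eqP; apply: contraTT ik => /kmin; rewrite -leqNgt.
Qed.

(** If the first difference came beyond the letters of the shorter word, that word would be a prefix
    of the other. *)
Lemma prefixes_diverge w w' x y : mkseq w (size x) = x -> mkseq w' (size y) = y ->
  ~~ prefix x y -> ~~ prefix y x ->
  exists k, [/\ diverge w w' k, (k < size x)%N & (k < size y)%N].
Proof.
move=> wx w'y xy yx.
have agree (v v' : nat -> 'I_N) (a b : seq 'I_N) :
    mkseq v (size a) = a -> mkseq v' (size b) = b -> (size a <= size b)%N ->
    (forall i, (i < size a)%N -> v i = v' i) -> prefix a b.
  move=> va v'b ab /eq_mkseqP vv'; apply/prefixP.
  exists (mkseq (iter (size a) shift v') (size b - size a)).
  by rewrite -[LHS]v'b -[X in X ++ _]va vv' -mkseq_add subnKC.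
have ww' : w <> w'.
  move=> E; subst w'; have [ab|/ltnW ba] := leqP (size x) (size y).
    by move: xy; rewrite (agree w w).
  by move: yx; rewrite (agree w w).
have [k kd] := words_diverge ww'; have [kE kN] := kd; exists k; split=> //.
- rewrite ltnNge; apply: contra xy => xk.
  have [ab|/ltnW ba] := leqP (size x) (size y).
    by apply: (agree w w') => // i ix; apply: kE; exact: leq_trans xk.
  exfalso; move: yx; rewrite (agree w' w)// => i iy; apply/esym/kE.
  exact: leq_trans (leq_trans iy ba) xk.
- rewrite ltnNge; apply: contra yx => yk.
  have [ba|/ltnW ab] := leqP (size y) (size x).
    by apply: (agree w' w) => // i iy; apply/esym/kE; exact: leq_trans yk.
  exfalso; move: xy; rewrite (agree w w')// => i ix; apply/kE.
  exact: leq_trans (leq_trans ix ab) yk.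
Qed.

End Words.

(** * The coding map and critical words *)

Section Codes.
Context {R : realType} {M : completeMetricType R} {N : nat}
  {S : 'I_N -> M -> M} {K : set M}.
Hypotheses (contrS : contractive S) (attrK : attractor S K)
  (injS : forall j, set_inj K (S j)).
Implicit Types (w : nat -> 'I_N) (x y : seq 'I_N) (p : M).

Lemma attractor_stable j a : K a -> K (S j a).
Proof. by case: attrK => _ _ KE Ka; rewrite KE; exists j => //; exists a. Qed.

Lemma wmap_stable x a : K a -> K (wmap S x a).
Proof. by move=> Ka; elim: x => //= i x; exact: attractor_stable. Qed.

Lemma wmap_inj x : set_inj K (wmap S x).
Proof.
elim: x => [|i x IHx] a b aK bK //= /(injS _ _) E; apply: IHx => //.
by apply: E; rewrite inE; apply: wmap_stable; rewrite -inE.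
Qed.

Lemma wmap_cat x y a : wmap S (x ++ y) a = wmap S x (wmap S y a).
Proof. by elim: x => //= i x ->. Qed.

Lemma cell_cat x y : cell S K (x ++ y) = wmap S x @` cell S K y.
Proof.
rewrite /cell image_comp; congr (_ @` _).
by apply/funext => a; rewrite /= wmap_cat.
Qed.

Lemma cell_sub x : cell S K x `<=` K.
Proof. by move=> _ [a Ka <-]; exact: wmap_stable. Qed.

Lemma cell_prefix x y : prefix x y -> cell S K y `<=` cell S K x.
Proof.
move=> /prefixP[t ->]; rewrite cell_cat => _ [a /cell_sub Ka <-].
by exists a.
Qed.

Lemma wmap_contract : exists2 r : R, 0 <= r < 1 & forall x a b,
  mdist (wmap S x a) (wmap S x b) <= r ^+ size x * mdist a b.
Proof.
have /choice[r_ rS] : forall j, exists r : R, 0 <= r < 1 /\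
    forall a b, mdist (S j a) (S j b) <= r * mdist a b.
  by move=> j; have [r r01 rS] := contrS j; exists r.
pose r := \big[Num.max/0]_j r_ j.
have r0 : 0 <= r by rewrite /r; elim/big_ind : _ => // [a b a0 b0|i _];
  [rewrite le_max a0|have [/andP[]] := rS i].
exists r => [|x a b].
  by rewrite r0 bigmax_lt// => j _; have [/andP[]] := rS j.
elim: x => [|i x IHx] /=; first by rewrite expr0 mul1r.
apply: le_trans ((rS i).2 _ _) _ => /=.
rewrite exprS -mulrA; apply: ler_pM (IHx); [|exact: mdist_ge0|exact: le_bigmax].
by have [/andP[]] := rS i.
Qed.

(** The relational form of [coding], free of its choice operator; [codes_coding] links the two. *)
Definition codes w p := forall k, cell S K (mkseq w k) p.

(** All cells along [w] contain both points, and their diameters tend to 0 by contraction. *)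
Lemma codes_uniq w p q : codes w p -> codes w q -> p = q.
Proof.
move=> wp wq; apply: contrapT => /eqP pq.
have [_ cK _] := attrK; have [D DK] := compact_mdist_bounded cK.
have [r r01 rS] := wmap_contract.
have D0 : 0 <= D.
  apply: le_trans (mdist_ge0 p q) (DK _ _ _ _).
    exact: cell_sub (wp 0%N).
  exact: cell_sub (wq 0%N).
have pq0 : 0 < mdist p q by rewrite mdist_gt0.
have D1 : 0 < D + 1 by rewrite ltr_wpDl.
have [n] := exprn_lt_eps r01 (divr_gt0 pq0 D1).
rewrite ltr_pdivlMr// => rn; have [/= a Ka pa] := wp n; have [b Kb qb] := wq n.
have := rS (mkseq w n) a b; rewrite pa qb size_mkseq leNgt => /negP; apply.
apply: le_lt_trans rn; rewrite ler_wpM2l ?exprn_ge0//; first by case/andP: r01.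
by apply: le_trans (DK _ _ Ka Kb) _; rewrite lerDl.
Qed.

Lemma codes_coding w p : codes w p -> coding S K w = p.
Proof.
move=> wp; have E : \bigcap_k cell S K (mkseq w k) = [set p].
  apply/seteqP; split=> [q wq|_ -> k _]; last exact: wp.
  by apply: codes_uniq wp => k; exact: wq.
have : \bigcap_k cell S K (mkseq w k) = [set coding S K w].
  by apply: (@getPex _ [set p | _ = [set p]]); exists p.
by rewrite E => /seteqP[/(_ p erefl)].
Qed.

Lemma codes_cons i w p : codes w p ->
  codes (fun k => if k is k'.+1 then w k' else i) (S i p).
Proof.
move=> wp [|k].
  by exists (S i p) => //; exact: attractor_stable (cell_sub (wp 0%N)).
rewrite mkseq_shift -cat1s cell_cat; exists p => //; exact: wp.
Qed.

(** A letter and a preimage in [K] are chosen for every point of [K]; iterating the choice spells a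
    code. *)
Lemma codes_exist p : K p -> exists w, codes w p.
Proof.
have [[a Ka] _ KE] := attrK.
have [i0 _ _] : (\bigcup_j (S j @` K)) a by rewrite -KE.
have /choice[f fS] : forall q, exists iq : 'I_N * M, K q -> K iq.2 /\ q = S iq.1 iq.2.
  move=> q; have [|nKq] := pselect (K q); last by exists (i0, a).
  by rewrite {1}KE => -[j _ [q' Kq' <-]]; exists (j, q').
pose w q k := (f (iter k (fun r => (f r).2) q)).1.
move=> Kp; exists (w p) => k; elim: k p Kp => [|k IHk] p Kp; first by exists p.
have [Kq pE] := fS _ Kp; have -> : mkseq (w p) k.+1 = (f p).1 :: mkseq (w (f p).2) k.
  by rewrite mkseq_shift; congr (_ :: _); apply: eq_mkseq => j; rewrite /shift /w iterSr.
by rewrite -cat1s cell_cat; exists (f p).2 => //; exact: IHk.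
Qed.

Lemma cell_codes x p : cell S K x p -> exists2 w, codes w p & mkseq w (size x) = x.
Proof.
case=> q Kq <-{p}; elim: x => [|i x [w wp wx]] /=.
  by have [w wq] := codes_exist Kq; exists w.
by exists (fun k => if k is k'.+1 then w k' else i);
  [exact: codes_cons|rewrite mkseq_shift wx].
Qed.

(** By injectivity, [p] has only one preimage in [K] under the first [k] maps. All longer prefixes
    share it, so it lies in every cell of the shifted word. *)
Lemma codes_shift k w p : codes w p -> exists2 p',
  codes (iter k shift w) p' & p = wmap S (mkseq w k) p'.
Proof.
move=> wp; have [p' Kp' pE] := wp k; exists p' => // j.
have := wp (k + j)%N; rewrite mkseq_add cell_cat -pE => -[p'' p''c].
move=> /wmap_inj <-; rewrite ?inE//; exact: cell_sub p''c.
Qed.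

(** Stripping the common prefix of [w], [w'] and [v] leaves, by injectivity, one and the same point.
    It lies in the cells of the distinct letters [w k] and [w' k], so each of its codes is
    critical. *)
Lemma diverge_critical k w w' v p : codes w p -> codes w' p -> diverge w w' k ->
  codes v p -> (forall i, (i < k)%N -> v i = w i) ->
  critical_set S K (iter k shift v).
Proof.
move=> wp w'p [/eq_mkseqP ww' wk] vp /eq_mkseqP vw.
have [q wq pE] := codes_shift k wp; have [q' w'q' pE'] := codes_shift k w'p.
have [q'' vq'' pE''] := codes_shift k vp.
have KC u r : codes u r -> K r by move=> /(_ 0%N)/cell_sub.
have qq' : q = q'.
  apply: (@wmap_inj (mkseq w k)); rewrite ?inE; [exact: KC wq|exact: KC w'q'|].
  by rewrite -pE ww'.
have qq'' : q = q''.
  apply: (@wmap_inj (mkseq w k)); rewrite ?inE; [exact: KC wq|exact: KC vq''|].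
  by rewrite -pE -vw.
subst q' q''.
rewrite /critical_set /preimage /= (codes_coding vq'').
exists (w k, w' k) => //=.
have hd u : codes (iter k shift u) q -> (S (u k) @` K) q.
  by move=> /(_ 1%N); rewrite /mkseq /= iter_shiftE addn0.
by split; exact: hd.
Qed.

Lemma diverge_post_critical k l w w' v p : codes w p -> codes w' p ->
  diverge w w' k -> codes v p -> (forall i, (i < k)%N -> v i = w i) -> (k < l)%N ->
  post_critical_set S K (iter l shift v).
Proof.
move=> wp w'p ww' vp vw kl; exists (l - k)%N; first by rewrite /= subn_gt0.
exists (iter k shift v); first exact: diverge_critical ww' vp vw.
by rewrite -iterD subnK// ltnW.
Qed.

End Codes.

Arguments codes {R M N} S K w p.

(** * The graph of an iterated function system *)

(** Choosing a related element of [F] for each element of [A] gives an injection. *)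
Lemma card_le_rel (T U : Type) (A : set T) (F : set U) (r : T -> U -> Prop) :
  (forall y, A y -> exists2 t, F t & r y t) ->
  (forall y y' t, A y -> A y' -> r y t -> r y' t -> y = y') ->
  (A #<= F)%card.
Proof.
move=> rex rinj; have [[y0 /rex[t0 _ _]]|A0] := pselect (A !=set0); last first.
  suff -> : A = set0 by exact: card_ge0.
  by rewrite -subset0 => y Ay; apply: A0; exists y.
have /choice[f fA] : forall y, exists t, A y -> F t /\ r y t.
  move=> y; have [/rex[t Ft rt]|nA] := pselect (A y); first by exists t.
  by exists t0.
have finj : {in A &, injective f}.
  move=> y y'; rewrite !inE => Ay Ay' E; apply: (rinj _ _ (f y)) => //.
    by case: (fA _ Ay).
  by rewrite E; case: (fA _ Ay').
have := inj_card_eq finj; rewrite card_eq_le => /andP[_ /card_le_trans]; apply.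
by apply: subset_card_le => _ [y Ay <-]; case: (fA _ Ay).
Qed.

(** * Separation of finitely many infinite words *)

Section Post.
Context {N : nat}.
Implicit Types (w : nat -> 'I_N).

Lemma eq_words w w' l : mkseq w l = mkseq w' l ->
  iter l shift w = iter l shift w' -> w = w'.
Proof.
move=> /eq_mkseqP pre suf; apply/funext => i.
have [/pre//|li] := ltnP i l.
by rewrite -(subnKC li) -!iter_shiftE suf.
Qed.

(** Two distinct words differ within finitely many letters; [m] is the maximum of these numbers over
    the finitely many pairs. *)
Lemma finite_words_separated (P : set (nat -> 'I_N)) : finite_set P ->
  exists m, forall w w', P w -> P w' -> mkseq w m = mkseq w' m -> w = w'.
Proof.
move=> /finite_seqP[r ->].
have /choice[d dP] : forall ww : (nat -> 'I_N) * (nat -> 'I_N), exists k,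
    mkseq ww.1 k = mkseq ww.2 k -> ww.1 = ww.2.
  move=> [w w'] /=; have [->|/words_diverge[k [_ wk]]] := pselect (w = w').
    by exists 0%N.
  by exists k.+1 => /eq_mkseqP/(_ _ (ltnSn k)) E; rewrite E eqxx in wk.
exists (\max_(w <- r) \max_(w' <- r) d (w, w')) => w w' /= wr w'r E.
apply: (dP (w, w')) => /=; apply/eq_mkseqP => i id; move/eq_mkseqP: E; apply.
apply: leq_trans id (leq_trans _ (leq_bigmax_seq w wr isT)).
exact: (leq_bigmax_seq w' w'r isT).
Qed.

End Post.

(** * Departure and bounded degree of the graph *)

Section Main.
Context {R : realType} {M : completeMetricType R} {N : nat}
  {S : 'I_N -> M -> M} {K : set M}.
Hypotheses (contrS : contractive S) (attrK : attractor S K)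
  (injS : forall j, set_inj K (S j)) (pcfS : pcf S K).

(* For given [p], the index [k] does not depend on the code [w] of [p]. *)
Definition branching p w k :=
  (exists2 v, codes S K v p & v k != w k) /\
  (forall v, codes S K v p -> forall i, (i < k)%N -> v i = w i).

Lemma branching_unique p w k k' : branching p w k -> branching p w k' -> k = k'.
Proof.
move=> [[v vp vk] kmin] [[v' v'p v'k'] k'min]; apply/eqP.
rewrite eqn_leq; apply/andP; split; rewrite leqNgt; apply/negP => lt.
  by rewrite (kmin _ v'p _ lt) eqxx in v'k'.
by rewrite (k'min _ vp _ lt) eqxx in vk.
Qed.

(** Let [k] be the first position at which some code of [p] leaves [w]. Before it all codes agree,
    so this one divergence makes the tails of every code beyond [k] post-critical. *)
Lemma codes_branching w w' p l : codes S K w p -> codes S K w' p ->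
  diverge w w' l -> exists k, [/\ (k <= l)%N, branching p w k &
    forall v i, codes S K v p -> (k < i)%N -> post_critical_set S K (iter i shift v)].
Proof.
move=> wp w'p [_ ww'l].
have ex : exists k, `[< exists2 v, codes S K v p & v k != w k >].
  by exists l; apply/asboolP; exists w' => //; rewrite eq_sym.
case: (ex_minnP ex) => k /asboolP[v vp vk] kmin.
have agree u : codes S K u p -> forall i, (i < k)%N -> u i = w i.
  move=> up i ik; apply/eqP; apply: contraTT ik => ui; rewrite -leqNgt.
  by apply: kmin; apply/asboolP; exists u.
have dv : diverge w v k.
  by split; [move=> i ik; apply/esym/agree|rewrite eq_sym].
exists k; split.
- by apply: kmin; apply/asboolP; exists w' => //; rewrite eq_sym.
- by split=> //; exists v.
- move=> u i up; apply: (diverge_post_critical _ _ _ wp vp dv up) => //.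
  exact: agree.
Qed.

Context {s : 'I_N -> R}.
Hypotheses (N_gt0 : (0 < N)%N) (s01 : forall j, 0 < s j < 1).
Implicit Types (u v x y z : vertex s).
Let E := AI_edge s S K.

Let K_neq0 : K !=set0. Proof. by case: attrK. Qed.

(** Distinct words of one level are incomparable for the prefix order. *)
Lemma same_level_diverge x y w w' : vlev x = vlev y -> x <> y ->
  mkseq w (size (val x)) = val x -> mkseq w' (size (val y)) = val y ->
  exists k, [/\ diverge w w' k, (k < size (val x))%N & (k < size (val y))%N].
Proof.
move=> xy nxy wx w'y; apply: prefixes_diverge => //.
  by apply/negP => /(same_level_prefix s01 xy).
by apply/negP => /(same_level_prefix s01 (esym xy))/esym.
Qed.

Lemma AI_hclose_vup u v : hclose E vlev u v -> hclose E vlev (vup u) (vup v).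
Proof.
move=> /(hclose_AI N_gt0 s01 _ _ _ K_neq0)[uv [p [pu pv]]].
apply/(hclose_AI N_gt0 s01 _ _ _ K_neq0); split; first by rewrite !vlev_up// uv.
by exists p; split; [move: pu|move: pv]; apply: cell_prefix; rewrite ?prefix_vup.
Qed.

Lemma AI_hclose_depart : exists2 m, (0 < m)%N &
  forall u v z, hclose E vlev u z -> hclose E vlev z v ->
    hclose E vlev (iter m vup u) (iter m vup v).
Proof.
have [m' m'P] := finite_words_separated pcfS.
have {m' m'P} [m m0 mP] : exists2 m, (0 < m)%N & forall w w',
    post_critical_set S K w -> post_critical_set S K w' ->
    mkseq w m = mkseq w' m -> w = w'.
  (* The successor makes [m] positive. *)
  exists m'.+1 => // w w' Pw Pw' /eq_mkseqP ww'; apply: m'P => //.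
  by apply/eq_mkseqP => i /leqW; exact: ww'.
exists m => // u v z; pose a x := iter m vup x.
have aK x p : cell S K (val x) p -> cell S K (val (a x)) p.
  by apply: cell_prefix => //; exact: prefix_iter_vup.
have lev_a x : vlev (a x) = (vlev x - m)%N.
  exact: (lev_iter (tree_edge_levelled N_gt0 s01)).
move=> /(hclose_AI N_gt0 s01 _ _ _ K_neq0)[uz [p [pu pz]]].
move=> /(hclose_AI N_gt0 s01 _ _ _ K_neq0)[zv [q [qz qv]]].
apply/(hclose_AI N_gt0 s01 _ _ _ K_neq0).
rewrite -/(a u) -/(a v); split; first by rewrite !lev_a uz zv.
(* If [z] shares its ancestor with [u], the point [q] common to the cells of [z] and [v] serves; the
   other case is symmetric. *)
have [auz|auz] := pselect (a z = a u).
  by exists q; rewrite -auz; split; exact: aK.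
have [avz|avz] := pselect (a z = a v).
  by exists p; rewrite -avz; split; exact: aK.
(* Otherwise [a z] and [a u] would both be the root. *)
have mz : (m <= vlev z)%N.
  rewrite leqNgt; apply/negP => /ltnW zm; apply: auz.
  have root x : vlev x = vlev z -> a x = vroot s.
    by move=> xz; apply: vlev_eq0; rewrite lev_a xz; apply/eqP; rewrite subn_eq0.
  by rewrite (root z erefl) (root u uz).
have post y r : vlev z = vlev y -> a z <> a y -> cell S K (val z) r ->
    cell S K (val y) r -> exists2 w, codes S K w r &
      mkseq w (size (val z)) = val z /\
      post_critical_set S K (iter (size (val (a z))) shift w).
  move=> zy nazy rz ry.
  have [w wr wz] := cell_codes attrK rz; have [w' w'r w'y] := cell_codes attrK ry.
  have waz := mkseq_prefix (prefix_iter_vup N_gt0 s01 m z) wz.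
  have w'ay := mkseq_prefix (prefix_iter_vup N_gt0 s01 m y) w'y.
  have lazy : vlev (a z) = vlev (a y) by rewrite !lev_a zy.
  have [k [kd kz _]] := same_level_diverge lazy nazy waz w'ay.
  exists w => //; split=> //.
  exact: (diverge_post_critical contrS attrK injS wr w'r kd wr).
have [w wp [wz wP]] := post u p (esym uz) auz pz pu.
have [w' w'q [w'z w'P]] := post v q zv avz qz qv.
(* Both words begin with [z], which has at least [m] letters beyond [a z]. Their post-critical tails
   after [a z] thus agree on [m] letters and coincide. *)
have ww' : w = w'.
  have /eq_mkseqP wE : mkseq w (size (val z)) = mkseq w' (size (val z)) by rewrite wz w'z.
  have zsize := size_iter_vup N_gt0 s01 mz.
  apply: (@eq_words _ _ _ (size (val (a z)))).
    by apply/eq_mkseqP => i iz; apply: wE; rewrite /a in iz; lia.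
  apply: mP => //; apply/eq_mkseqP => i im; rewrite !iter_shiftE; apply: wE.
  by rewrite /a; lia.
have pq : p = q by apply: (codes_uniq contrS attrK wp); rewrite ww'.
by exists p; split; [exact: aK|rewrite pq; exact: aK].
Qed.

Local Notation word := (nat -> 'I_N).

(* A neighbour [y] of [x] is its parent, a child [x ++ t], or is read off a point
   [p] common to the two cells. In the last case [alpha] determines the
   code [w] of [p] through [x], hence [p] and [k], and then [i] and [omega]
   determine the code [w'] of [p] through [y]. *)
Definition neighbour_code x y (c : option (seq 'I_N + (word * 'I_N * word))) : Prop :=
  match c with
  | None => y = vup x
  | Some (inl t) => val y = val x ++ t
  | Some (inr (alpha, i, omega)) => exists p w w' k,
      [/\ vlev x = vlev y, codes S K w p, codes S K w' p & branching p w k] /\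
      [/\ mkseq w (size (val x)) = val x, mkseq w' (size (val y)) = val y,
          iter (size (val x)) shift w = alpha, w' k = i &
          iter k.+1 shift w' = omega]
  end.

Lemma neighbour_code_inj x y y' c :
  neighbour_code x y c -> neighbour_code x y' c -> y = y'.
Proof.
case: c => [[t|[[alpha i] omega]]|] /=; last by move=> ->.
  by move=> yt y't; apply: val_inj; exact: etrans yt (esym y't).
move=> [p [w [w' [k [[xy wp w'p kp] [wx w'y wa w'i w'o]]]]]].
move=> [q [v [v' [l [[xy' vq v'q lq] [vx v'y va v'i v'o]]]]]].
have wv : w = v by apply: (@eq_words _ _ _ (size (val x))); rewrite ?wx ?wa.
subst v; have pq := codes_uniq contrS attrK wp vq; subst q.
have kl := branching_unique kp lq; subst l.
have w'v' : w' = v'.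
  apply: (@eq_words _ _ _ k.+1); last exact: etrans w'o (esym v'o).
  (* Before [k] every code of [p] agrees with [w]; the letter at [k] is [i]. *)
  apply/eq_mkseqP => j; rewrite ltnS leq_eqVlt => /predU1P[->|jk].
    by rewrite w'i.
  by rewrite (kp.2 _ w'p _ jk) (kp.2 _ v'q _ jk).
subst v'; apply: contrapT => yy'.
have [k0 [[_ /eqP//]]] := same_level_diverge (etrans (esym xy) xy') yy' w'y v'y.
Qed.

Lemma AI_bounded_degree : bounded_degree E.
Proof.
have [F finF Fchild] := X_child_finite N_gt0 s01.
pose P := post_critical_set S K.
(* The three pieces encode the parent, the children and the horizontal neighbours. *)
pose G : set (option (seq 'I_N + (word * 'I_N * word))) :=
  [set None] `|` (Some \o inl) @` F `|` (Some \o inr) @` (P `*` [set: 'I_N] `*` P).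
have : finite_set G.
  rewrite !finite_setU; split; [split; [exact: finite_set1|exact: finite_image]|].
  apply: finite_image; apply: finite_setX; last exact: pcfS.
  by apply: finite_setX; [exact: pcfS|exact: finite_finset].
move=> /finite_setP[B GB]; exists B => x.
apply: (@card_le_trans _ _ _ G); last by move: GB; rewrite card_eq_le => /andP[].
apply: (@card_le_rel _ _ _ _ (neighbour_code x)) => [y xy|y y' c _ _]; last first.
  exact: neighbour_code_inj.
case/orP: xy => [/(tree_edge_lev N_gt0 s01)[[lxy yx]|[_ <-]]|/asboolP].
- have /prefixP[t yt] : prefix (val x) (val y) by rewrite -yx prefix_vup.
  exists (Some (inl t)) => //; left; right; exists t => //.
  apply: (Fchild (vlev x) (val x)); first exact: X_vlev.
  by rewrite -yt -lxy; exact: X_vlev.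
- by exists None => //; left; left.
move=> /(AI_horizontalP N_gt0 s01)[lxy /eqP nxy [p [px py]]].
have [w wp wx] := cell_codes attrK px; have [w' w'p w'y] := cell_codes attrK py.
have [l [ld lx _]] := same_level_diverge lxy nxy wx w'y.
have [k [kl kp kP]] := codes_branching wp w'p ld.
(* Both shifts pass the branching index, as [k <= l < size (val x)], so both tails are
   post-critical. *)
exists (Some (inr (iter (size (val x)) shift w, w' k, iter k.+1 shift w'))).
  right; eexists; last by [].
  split; last exact: kP w'p (ltnSn k).
  by split=> //; exact: kP wp (leq_ltn_trans kl lx).
by exists p, w, w', k.
Qed.

End Main.

Theorem theorem1p6 (R : realType) (M : completeMetricType R) (N : nat)
    (S : 'I_N -> M -> M) (K : set M) :
  (2 <= N)%N ->
  contractive S ->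
  attractor S K ->
  (forall j, set_inj K (S j)) ->
  pcf S K ->
  forall s : 'I_N -> R, (forall j, 0 < s j < 1) ->
  let E := AI_edge s S K in
  let o := vroot s in
  [/\ simple_graph E,
      exists2 m : nat, (0 < m)%N & departing R E o m 1,
      expansive R E o,
      bounded_degree E &
      [/\ hyperbolic R E o,
          vertical R E o =2 tree_edge s &
          is_tree (tree_edge s)]].
Proof.
move=> /ltnW N_gt0 contrS attrK injS pcfS s s01 E o.
have EL := AI_edge_levelled N_gt0 s01 S K.
have vup_close := AI_hclose_vup attrK N_gt0 s01.
have [m m0 depart] := AI_hclose_depart contrS attrK injS pcfS N_gt0 s01.
split; [|exists m => //|..|split].
- by split; [exact: (levelled_sym EL)|exact: (levelled_irr EL)].
- exact: (levelled_departing EL depart).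
- exact: (levelled_expansive EL vup_close).
- exact: AI_bounded_degree.
- exact: (levelled_hyperbolic EL vup_close depart).
- exact: AI_vertical.
- exact: (levelled_tree (tree_edge_levelled N_gt0 s01) (tree_edge_lev_neq N_gt0 s01)).
Qed.
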